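(* For all positive integers $r,n$, the following identity holds in $\mathbb{Z}[[z_0,\ldots,z_n]]$: \[ \sum_{ k \ge 0 } \prod_{ j=1 }^n [rk+1]_{ z_j } \, z_0^k \ = \ \sum_{ (\pi,\epsilon)\in \mathbb{Z}_r\wr S_n } \frac{ \displaystyle z_0^{\left\lceil \operatorname{ch}(\epsilon)/r \right\rceil } \prod_{j=1}^nz_{\pi(1)}^{a_j^\epsilon}z_{\pi(2)}^{a_j^\epsilon}\cdots z_{\pi(j)}^{a_j^\epsilon} \prod_{\substack{j\in \mathrm{Des}(\pi) \\ a_j^\epsilon=0 }}z_0z_{\pi(1)}^rz_{\pi(2)}^r\cdots z_{\pi(j)}^r }{ \displaystyle \prod_{ j=0 }^n \left( 1 - z_0 \, z_{\pi(1) }^{r} z_{\pi(2) }^{r} \cdots z_{\pi(j)}^{r} \right) } \, , \] where the $j=0$ factor in the denominator is $1-z_0$.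
   Context: $[m]_z=1+z+\cdots+z^{m-1}$. For $\pi\in S_n$, $\mathrm{Des}(\pi)=\{j\in[n-1]:\pi(j)>\pi(j+1)\}$. With $\omega=e^{2\pi i/r}$, $\mathbb{Z}_r\wr S_n$ is the set of pairs $(\pi,\epsilon)$, $\pi\in S_n$, $\epsilon=(\omega^{c_1},\ldots,\omega^{c_n})$, $c_j\in\{0,\ldots,r-1\}$. With $c_{n+1}:=0$, $a_j^\epsilon=(c_j-c_{j+1})\bmod r$ for $j\in[n]$, and the total color change is $\operatorname{ch}(\epsilon)=\sum_{j=1}^n a_j^\epsilon$. *)

(* Defs.v *)
From HB Require Import structures.
From mathcomp Require Import all_boot all_order all_fingroup all_algebra.
From mathcomp Require Import boolp.
From mathcomp Require Export mpoly.

Set Implicit Arguments.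
Unset Strict Implicit.
Unset Printing Implicit Defensive.

Import GRing.Theory.
Local Open Scope ring_scope.

(* R[[z_0, ..., z_(n-1)]]: a power series is its coefficient function on the  *)
(* multidegrees 'X_{1..n}; equality is extensional by funext, and the eqType  *)
(* and choiceType structures are the classical ones.                          *)

Record mpseries (n : nat) (R : Type) : Type :=
  MPSeries { mpscoef : 'X_{1..n} -> R }.

HB.instance Definition _ n (R : Type) := gen_eqMixin (mpseries n R).
HB.instance Definition _ n (R : Type) := gen_choiceMixin (mpseries n R).

Lemma mpseriesP n (R : Type) (f g : mpseries n R) :
  mpscoef f =1 mpscoef g <-> f = g.
Proof.
split=> [|-> //]; case: f g => [f] [g] /= fg.
by congr MPSeries; apply/funext.
Qed.

Lemma mdeg_addend n (m a b : 'X_{1..n}) : m == (a + b)%MM ->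
  (mdeg a <= mdeg m)%N /\ (mdeg b <= mdeg m)%N.
Proof. by move=> /eqP ->; rewrite mdegD leq_addr leq_addl. Qed.

Section Zmodule.
Variables (n : nat) (R : comNzRingType).
Implicit Types f g h : mpseries n R.

Definition mps_zero : mpseries n R := MPSeries (fun=> 0).
Definition mps_opp f : mpseries n R := MPSeries (fun m => - mpscoef f m).
Definition mps_add f g : mpseries n R :=
  MPSeries (fun m => mpscoef f m + mpscoef g m).

Fact mps_addA : associative mps_add.
Proof. by move=> f g h; apply/mpseriesP => m /=; rewrite addrA. Qed.
Fact mps_addC : commutative mps_add.
Proof. by move=> f g; apply/mpseriesP => m /=; rewrite addrC. Qed.
Fact mps_add0 : left_id mps_zero mps_add.
Proof. by move=> f; apply/mpseriesP => m /=; rewrite add0r. Qed.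
Fact mps_addN : left_inverse mps_zero mps_opp mps_add.
Proof. by move=> f; apply/mpseriesP => m /=; rewrite addNr. Qed.

HB.instance Definition _ := GRing.isZmodule.Build (mpseries n R)
  mps_addA mps_addC mps_add0 mps_addN.

Lemma mpscoef0 m : mpscoef (0 : mpseries n R) m = 0. Proof. by []. Qed.
Lemma mpscoefN f m : mpscoef (- f) m = - mpscoef f m. Proof. by []. Qed.
Lemma mpscoefD f g m : mpscoef (f + g) m = mpscoef f m + mpscoef g m.
Proof. by []. Qed.
Lemma mpscoefB f g m : mpscoef (f - g) m = mpscoef f m - mpscoef g m.
Proof. by []. Qed.

Lemma mpscoef_sum (I : Type) (s : seq I) (P : pred I) (F : I -> mpseries n R) m :
  mpscoef (\sum_(i <- s | P i) F i) m = \sum_(i <- s | P i) mpscoef (F i) m.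
Proof. by elim/big_rec2: _ => // i y1 y2 _ <-. Qed.

End Zmodule.

Section Ring.
Variables (n : nat) (R : comNzRingType).
Implicit Types f g h : mpseries n R.

Definition mps_one : mpseries n R := MPSeries (fun m => (m == 0%MM)%:R).

(* Cauchy product; the pairs (k.1, k.2) range over bounded multidegrees only  *)
(* so that the index type is finite.                                          *)
Definition mps_mul f g : mpseries n R :=
  MPSeries (fun m =>
    \sum_(k : 'X_{1..n < (mdeg m).+1, (mdeg m).+1} | m == (k.1 + k.2)%MM)
      mpscoef f k.1 * mpscoef g k.2).

Definition mps_trunc d f : {mpoly R[n]} :=
  \sum_(m : 'X_{1..n < d}) mpscoef f m *: 'X_[m].

Lemma mcoeff_trunc d f m :
  (mdeg m < d)%N -> (mps_trunc d f)@_m = mpscoef f m.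
Proof. exact: mcoeff_mpoly. Qed.

Lemma mps_mul_trunc d1 d2 f g m : (mdeg m < d1)%N -> (mdeg m < d2)%N ->
  mpscoef (mps_mul f g) m = (mps_trunc d1 f * mps_trunc d2 g)@_m.
Proof.
move=> lt1 lt2; rewrite mcoeffM /=; apply: eq_bigr => -[k1 k2] /= /mdeg_addend[le1 le2].
by rewrite !mcoeff_trunc // (leq_ltn_trans le1, leq_ltn_trans le2).
Qed.

Lemma mcoeffM_eq (p p' q q' : {mpoly R[n]}) d m : (mdeg m < d)%N ->
    (forall k, (mdeg k < d)%N -> p@_k = p'@_k) ->
    (forall k, (mdeg k < d)%N -> q@_k = q'@_k) ->
  (p * q)@_m = (p' * q')@_m.
Proof.
move=> ltm pE qE; rewrite !mcoeffM; apply: eq_bigr => -[k1 k2] /= /mdeg_addend[le1 le2].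
by rewrite pE ?qE // (leq_ltn_trans le1, leq_ltn_trans le2).
Qed.

Lemma mcoeff_trunc_mul d f g k : (mdeg k < d)%N ->
  (mps_trunc d (mps_mul f g))@_k = (mps_trunc d f * mps_trunc d g)@_k.
Proof. by move=> ltk; rewrite mcoeff_trunc // (@mps_mul_trunc d d). Qed.

Fact mps_mulA : associative mps_mul.
Proof.
move=> f g h; apply/mpseriesP => m; set d := (mdeg m).+1.
rewrite !(@mps_mul_trunc d d) //.
rewrite (@mcoeffM_eq _ (mps_trunc d f) _ (mps_trunc d g * mps_trunc d h) d) //;
  last exact: mcoeff_trunc_mul.
rewrite mulrA; apply: (@mcoeffM_eq _ _ _ _ d) => // k ltk.
by rewrite mcoeff_trunc_mul.
Qed.

Fact mps_mulC : commutative mps_mul.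
Proof.
move=> f g; apply/mpseriesP => m; set d := (mdeg m).+1.
by rewrite !(@mps_mul_trunc d d) // mulrC.
Qed.

Fact mps_mul1 : left_id mps_one mps_mul.
Proof.
move=> f; apply/mpseriesP => m; set d := (mdeg m).+1.
rewrite (@mps_mul_trunc d d) //.
rewrite (@mcoeffM_eq _ 1 _ (mps_trunc d f) d) ?mul1r ?mcoeff_trunc //.
by move=> k ltk; rewrite mcoeff_trunc // mcoeff1.
Qed.

Fact mps_mulDl : left_distributive mps_mul +%R.
Proof.
move=> f g h; apply/mpseriesP => m /=; rewrite -big_split /=.
by apply: eq_bigr => k _; rewrite mulrDl.
Qed.

Fact mps_one_neq0 : mps_one != 0.
Proof.
apply/eqP => /mpseriesP /(_ 0%MM) /= /eqP.
by rewrite eqxx oner_eq0.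
Qed.

HB.instance Definition _ := GRing.Zmodule_isComNzRing.Build (mpseries n R)
  mps_mulA mps_mulC mps_mul1 mps_mulDl mps_one_neq0.

Lemma mpscoef1 m : mpscoef (1 : mpseries n R) m = (m == 0%MM)%:R.
Proof. by []. Qed.

Lemma mpscoefM f g m : mpscoef (f * g) m =
  \sum_(k : 'X_{1..n < (mdeg m).+1, (mdeg m).+1} | m == (k.1 + k.2)%MM)
    mpscoef f k.1 * mpscoef g k.2.
Proof. by []. Qed.

Lemma mpscoefM_eq f f' g g' m :
    (forall k, (mdeg k <= mdeg m)%N -> mpscoef f k = mpscoef f' k) ->
    (forall k, (mdeg k <= mdeg m)%N -> mpscoef g k = mpscoef g' k) ->
  mpscoef (f * g) m = mpscoef (f' * g') m.
Proof.
move=> fE gE; rewrite !mpscoefM; apply: eq_bigr => -[k1 k2] /= /mdeg_addend[le1 le2].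
by rewrite fE ?gE.
Qed.

Lemma mpscoef0M f g :
  mpscoef (f * g) 0%MM = mpscoef f 0%MM * mpscoef g 0%MM.
Proof.
rewrite (@mps_mul_trunc 1 1) ?mdeg0 //.
by rewrite (rmorphM (mcoeff 0%MM)) /= !mcoeff_trunc ?mdeg0.
Qed.

Definition mpsC (c : R) : mpseries n R :=
  MPSeries (fun m => if m == 0%MM then c else 0).

Definition mpsX (i : 'I_n) : mpseries n R :=
  MPSeries (fun m => (m == U_(i)%MM)%:R).

Lemma mpscoefX_lt f j m : mpscoef f 0%MM = 0 -> (mdeg m < j)%N ->
  mpscoef (f ^+ j) m = 0.
Proof.
move=> f0; elim: j m => // j IHj m; rewrite ltnS exprS => lem.
rewrite mpscoefM big1 // => -[k1 k2] /=.
move: (bmnm k1) (bmnm k2) => a b /eqP mE.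
have [->|aN0] := eqVneq a 0%MM; first by rewrite f0 mul0r.
rewrite IHj ?mulr0 // (leq_trans _ lem) // mE mdegD -[X in (X < _)%N]add0n.
by rewrite ltn_add2r lt0n mdeg_eq0.
Qed.

(* F_0 + F_1 + ... = S in the formal topology: each coefficient of the        *)
(* partial sums is eventually constant, equal to that of S.                   *)
Definition is_mpsum (F : nat -> mpseries n R) (S : mpseries n R) : Prop :=
  forall m, exists N, forall M, (N <= M)%N ->
    mpscoef (\sum_(k < M) F k) m = mpscoef S m.

End Ring.

Section UnitRing.
Variables (n : nat) (R : comUnitRingType).
Implicit Types f g h : mpseries n R.

Definition mps_unit : pred (mpseries n R) :=
  fun f => mpscoef f 0%MM \is a GRing.unit.

(* With u the constant term of f, f^-1 is the geometric series                *)
(* u^-1 * sum_j (1 - u^-1 f)^j; only j <= |m| contributes in degree m.        *)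
Definition mps_geom d f : mpseries n R :=
  let v := mpsC n (mpscoef f 0%MM)^-1 in
  v * \sum_(j < d) (1 - v * f) ^+ j.

Definition mps_inv f : mpseries n R :=
  if mps_unit f then
    MPSeries (fun m => mpscoef (mps_geom (mdeg m).+1 f) m)
  else f.

Fact mps_mulV : {in mps_unit, left_inverse 1 mps_inv *%R}.
Proof.
move=> f fU; rewrite /mps_inv (fU : mps_unit f).
apply/mpseriesP => m; set v := mpsC n (mpscoef f 0%MM)^-1.
have g0 : mpscoef (1 - v * f) 0%MM = 0.
  by rewrite mpscoefB mpscoef1 eqxx mpscoef0M /= eqxx mulVr // subrr.
have geomE k : (mdeg k <= mdeg m)%N ->
    mpscoef (mps_geom (mdeg k).+1 f) k = mpscoef (mps_geom (mdeg m).+1 f) k.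
  move=> lek; rewrite /mps_geom -/v; apply: mpscoefM_eq => // l lel.
  have -> : (mdeg m).+1 = ((mdeg k).+1 + (mdeg m - mdeg k))%N.
    by rewrite addSn subnKC.
  rewrite [in RHS]big_split_ord /= [RHS]mpscoefD [X in _ = _ + X]mpscoef_sum.
  rewrite [X in _ = _ + X]big1 ?addr0 // => i _.
  by rewrite mpscoefX_lt // ltnS (leq_trans lel) ?leq_addr.
rewrite (@mpscoefM_eq _ _ _ (mps_geom (mdeg m).+1 f) _ f) //.
have -> : mps_geom (mdeg m).+1 f * f = 1 - (1 - v * f) ^+ (mdeg m).+1.
  rewrite /mps_geom -/v mulrAC -[RHS]opprB subrX1.
  by rewrite -[RHS]mulNr opprB opprB [_ + (v * f - 1)]addrC subrK.
by rewrite mpscoefB mpscoefX_lt // subr0.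
Qed.

Fact mps_unitPl f g : g * f = 1 -> mps_unit f.
Proof.
move=> /(congr1 (fun h => mpscoef h 0%MM)).
rewrite mpscoef0M mpscoef1 eqxx => gf1.
by apply/unitrPr; exists (mpscoef g 0%MM); rewrite mulrC.
Qed.

Fact mps_inv_out : {in [predC mps_unit], mps_inv =1 id}.
Proof. by move=> f /negbTE fU; rewrite /mps_inv [mps_unit f]fU. Qed.

HB.instance Definition _ := GRing.ComNzRing_hasMulInverse.Build (mpseries n R)
  mps_mulV mps_unitPl mps_inv_out.

Lemma mpseries_unitE f :
  (f \is a GRing.unit) = (mpscoef f 0%MM \is a GRing.unit).
Proof. by []. Qed.

End UnitRing.

Definition qint (A : pzRingType) (m : nat) (z : A) : A := \sum_(i < m) z ^+ i.

(* Positions and letters are numbered from 0: the index j in [n] is the       *)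
(* ordinal j - 1, so that j in [n-1] becomes an i : 'I_n with i.+1 < n.       *)
Definition Des n (p : 'S_n) : {set 'I_n} :=
  [set i : 'I_n | [exists i' : 'I_n, (i' == i.+1 :> nat) && (p i' < p i)%N]].

(* The pair (pi, epsilon), epsilon being given by its exponents (c_1,...,c_n) *)
(* in {0, ..., r-1}: epsilon_j = omega ^ c_j, omega a primitive r-th root.    *)
Definition wreath (r n : nat) : Type := ('S_n * {ffun 'I_n -> 'I_r})%type.
HB.instance Definition _ r n := Finite.on (wreath r n).

(* c_(j+1) for j < n, and 0 beyond (the convention c_(n+1) = 0).              *)
Definition color r n (c : {ffun 'I_n -> 'I_r}) (j : nat) : nat :=
  if insub j is Some i then c i else 0%N.

Definition color_change r n (c : {ffun 'I_n -> 'I_r}) (j : 'I_n) : nat :=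
  `|(((color c j)%:Z - (color c j.+1)%:Z) %% r%:Z)%Z|%N.

Definition total_change r n (c : {ffun 'I_n -> 'I_r}) : nat :=
  (\sum_(j < n) color_change c j)%N.

Definition ceil_div (a b : nat) : nat := `|Num.ceil (a%:Q / b%:Q)|%N.

Section Series.
Variables r n : nat.

Definition z0 : mpseries n.+1 int := mpsX int ord0.
Definition zv (j : 'I_n) : mpseries n.+1 int := mpsX int (lift ord0 j).

(* z_(pi(1))^e ... z_(pi(j))^e *)
Definition zprefix (p : 'S_n) (j e : nat) : mpseries n.+1 int :=
  \prod_(i < n | (i < j)%N) zv (p i) ^+ e.

Definition wreath_num (w : wreath r n) : mpseries n.+1 int :=
  z0 ^+ ceil_div (total_change w.2) r
  * \prod_(j < n) zprefix w.1 j.+1 (color_change w.2 j)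
  * \prod_(j in Des w.1 | color_change w.2 j == 0%N) (z0 * zprefix w.1 j.+1 r).

Definition wreath_den (w : wreath r n) : mpseries n.+1 int :=
  \prod_(j < n.+1) (1 - z0 * zprefix w.1 j r).

Lemma wreath_den_unit (w : wreath r n) : wreath_den w \is a GRing.unit.
Proof.
apply/unitr_prod_in => j _; rewrite mpseries_unitE mpscoefB mpscoef1 mpscoef0M.
suff -> : mpscoef z0 0%MM = 0 by rewrite mul0r subr0 eqxx unitr1.
by rewrite /= eq_sym -mdeg_eq0 mdeg1.
Qed.

End Series.

(* Main.v *)
(* The left-hand side is the generating function of the cone over the cube    *)
(* [0, r]^n: the coefficient of z_0^k z^v is 1 if max v <= r k, and 0         *)
(* otherwise. On the right, expanding the geometric series, it counts the     *)
(* triples (pi, epsilon, b) with b_0, ..., b_n >= 0 whose monomial is         *)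
(* z_0^k z^v, i.e. such that                                                  *)
(*   v_(pi(j)) - v_(pi(j+1)) = a_j + r ([j in Des pi, a_j = 0] + b_j),        *)
(* with v_(pi(n+1)) = 0, and z_0 has total exponent k. Modulo r this forces   *)
(* c_j = v_(pi(j)) mod r. A tie v_(pi(j)) = v_(pi(j+1)) excludes a descent    *)
(* at j, so pi sorts v decreasingly, breaking ties increasingly, and is       *)
(* unique; then b_1, ..., b_n are determined by Euclidean division of the     *)
(* differences by r. Summing the differences, the exponent of z_0 is          *)
(* b_0 + ceil (max v / r), so b_0 exists, uniquely, iff max v <= r k.         *)

Require Import Defs.
From mathcomp Require Import all_boot all_order all_fingroup all_algebra.
From mathcomp Require Import zify.

Set Implicit Arguments.
Unset Strict Implicit.
Unset Printing Implicit Defensive.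

Import Order.TTheory GRing.Theory Num.Theory.
Local Open Scope nat_scope.

(** * Power series with monomial terms *)

Lemma is_mpsum_graded (n : nat) (R : comNzRingType) (grade : 'X_{1..n} -> nat)
    (F : nat -> mpseries n R) (S : mpseries n R) :
    (forall k m, k != grade m -> mpscoef (F k) m = 0%R) ->
    (forall m, mpscoef S m = mpscoef (F (grade m)) m) ->
  is_mpsum F S.
Proof.
move=> F_graded SE m; exists (grade m).+1 => M lt_M.
rewrite SE mpscoef_sum (bigD1 (Ordinal lt_M)) //= big1 ?addr0 // => k neq_k.
exact: F_graded.
Qed.

Section Monomials.
Variables (n : nat) (R : comNzRingType).
Implicit Types (f g : mpseries n R) (a b m : 'X_{1..n}).
Local Open Scope ring_scope.

Definition mps_mon m : mpseries n R := MPSeries (fun m' => (m' == m)%:R).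

Lemma mps_mon0 : mps_mon 0%MM = 1. Proof. by []. Qed.

Lemma mps_monD a b : mps_mon (a + b)%MM = mps_mon a * mps_mon b.
Proof.
apply/mpseriesP => m; pose d := (mdeg m).+1.
have truncE c k : (mdeg k < d)%N -> (mps_trunc d (mps_mon c))@_k = 'X_[c]@_k.
  by move=> lt_kd; rewrite mcoeff_trunc // mcoeffX eq_sym.
rewrite (@mps_mul_trunc _ _ d d) // (mcoeffM_eq _ (truncE a) (truncE b)) //.
by rewrite -mpolyXD mcoeffX eq_sym.
Qed.

Lemma mps_monMn m e : mps_mon (m *+ e)%MM = mps_mon m ^+ e.
Proof. by elim: e => [|e IHe]; rewrite ?mulm0n // mulmS mps_monD IHe exprS. Qed.

Lemma mps_mon_sum (I : Type) (s : seq I) (P : pred I) (F : I -> 'X_{1..n}) :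
  mps_mon (\sum_(i <- s | P i) F i)%MM = \prod_(i <- s | P i) mps_mon (F i).
Proof. exact: (big_morph mps_mon mps_monD mps_mon0). Qed.

Lemma mps_mon_prodX m : mps_mon m = \prod_i mpsX R i ^+ m i.
Proof.
rewrite {1}[m]multinomUE_id mps_mon_sum.
by apply: eq_bigr => i _; rewrite mps_monMn.
Qed.

Lemma mpscoef_mon0 m : m != 0%MM -> mpscoef (mps_mon m) 0%MM = 0.
Proof. by rewrite /= eq_sym => /negPf->. Qed.

Lemma mpscoef_sum_mon_unique (I : finType) (F : I -> 'X_{1..n}) m (P : bool) :
    (forall i i', m = F i -> m = F i' -> i = i') ->
    (exists i, m = F i) <-> P ->
  mpscoef (\sum_i mps_mon (F i)) m = P%:R.
Proof.
move=> F_unique F_ex; rewrite mpscoef_sum /=.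
case: P F_ex => [[_ F_ex] | [F_none _]].
  have [//|i mE] := F_ex.
  rewrite (bigD1 i) //= -mE eqxx big1 ?addr0 // => i' /eqP neq_i.
  by case: eqP => // mE'; case: neq_i; apply: F_unique.
by rewrite big1 // => i _; case: eqP => // mE; have := F_none (ex_intro _ i mE).
Qed.

Definition eq_upto d f g : Prop :=
  forall m, (mdeg m <= d)%N -> mpscoef f m = mpscoef g m.

Lemma eq_uptoM d f f' g g' :
  eq_upto d f f' -> eq_upto d g g' -> eq_upto d (f * g) (f' * g').
Proof.
move=> ff' gg' m le_md; apply: mpscoefM_eq => k le_km; [apply: ff'|apply: gg'];
exact: leq_trans le_km le_md.
Qed.

Lemma eq_upto_prod d (I : Type) (s : seq I) (P : pred I)
    (F G : I -> mpseries n R) :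
    (forall i, P i -> eq_upto d (F i) (G i)) ->
  eq_upto d (\prod_(i <- s | P i) F i) (\prod_(i <- s | P i) G i).
Proof.
by move=> FG; elim/big_rec2: _ => // i f g Pi; apply: eq_uptoM; apply: FG.
Qed.

End Monomials.

Arguments mps_mon {n} R m.

Section GeometricSeries.
Variables (n : nat) (R : comUnitRingType).
Implicit Types (f : mpseries n R) (c m : 'X_{1..n}).
Local Open Scope ring_scope.

Lemma mps_unit_1B f : mpscoef f 0%MM = 0 -> 1 - f \is a GRing.unit.
Proof.
by rewrite mpseries_unitE mpscoefB mpscoef1 eqxx => ->; rewrite subr0 unitr1.
Qed.

Lemma eq_upto_geom d f : mpscoef f 0%MM = 0 ->
  eq_upto d (1 - f)^-1 (\sum_(e < d.+1) f ^+ e).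
Proof.
move=> f0 m le_md; have f_unit := mps_unit_1B f0.
have -> : (1 - f)^-1 = \sum_(e < d.+1) f ^+ e + f ^+ d.+1 / (1 - f).
  apply: (mulrI f_unit); rewrite mulrDr mulrCA !mulrV // mulr1.
  by rewrite -[1 - f]opprB mulNr -subrX1 opprB subrK.
rewrite mpscoefD [X in _ + X]mpscoefM [X in _ + X]big1 ?addr0 //.
move=> -[k1 k2] /= /mdeg_addend[le_k1m _].
by rewrite mpscoefX_lt ?mul0r // ltnS (leq_trans le_k1m).
Qed.

Section MonomialDenominator.
Variables (I : finType) (a : I -> 'X_{1..n}).
Hypothesis a_neq0 : forall i, a i != 0%MM.

Lemma mpscoef_mon_div_prod c m :
  mpscoef (mps_mon R c / \prod_i (1 - mps_mon R (a i))) m =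
  mpscoef (\sum_(b : {ffun I -> 'I_(mdeg m).+1})
             mps_mon R (c + \sum_i a i *+ b i)%MM) m.
Proof.
have a0 i : mpscoef (mps_mon R (a i)) 0%MM = 0 by exact: mpscoef_mon0.
have -> : \sum_(b : {ffun I -> 'I_(mdeg m).+1})
            mps_mon R (c + \sum_i a i *+ b i)%MM =
          mps_mon R c * \prod_i \sum_(e < (mdeg m).+1) mps_mon R (a i) ^+ e.
  rewrite bigA_distr_bigA mulr_sumr; apply: eq_bigr => b _.
  rewrite mps_monD mps_mon_sum; congr (_ * _).
  by apply: eq_bigr => i _; rewrite mps_monMn.
rewrite -prodrV => [|i _]; last exact: mps_unit_1B.
apply: (@eq_uptoM _ _ (mdeg m)) (leqnn _) => [//|].
by apply: eq_upto_prod => i _; exact: eq_upto_geom.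
Qed.

Lemma leq_mdeg_lincomb c (b : I -> nat) i :
  (b i <= mdeg (c + \sum_j a j *+ b j)%MM)%N.
Proof.
rewrite mdegD mdeg_sum (bigD1 i) //= mdegMn addnCA -[leqLHS]mul1n.
by rewrite (leq_trans _ (leq_addr _ _)) // leq_mul // lt0n mdeg_eq0.
Qed.

End MonomialDenominator.

Lemma mpscoef_sum_mon_div_prod_unique (W I : finType)
    (c : W -> 'X_{1..n}) (a : W -> I -> 'X_{1..n}) m (P : bool) :
    (forall w i, a w i != 0%MM) ->
    (forall w w' (b b' : I -> nat),
       m = (c w + \sum_i a w i *+ b i)%MM ->
       m = (c w' + \sum_i a w' i *+ b' i)%MM -> w = w' /\ b =1 b') ->
    (exists w (b : I -> nat), m = (c w + \sum_i a w i *+ b i)%MM) <-> P ->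
  mpscoef (\sum_w mps_mon R (c w) / \prod_i (1 - mps_mon R (a w i))) m = P%:R.
Proof.
move=> a_neq0 rep_unique rep_ex; rewrite mpscoef_sum.
rewrite (eq_bigr _ (fun w _ => mpscoef_mon_div_prod (a_neq0 w) (c w) m)).
rewrite -mpscoef_sum pair_bigA /=; apply: mpscoef_sum_mon_unique.
  move=> [w b] [w' b'] /= mE mE'; have [-> bb'] := rep_unique _ _ _ _ mE mE'.
  by congr (_, _); apply/ffunP => i; apply: val_inj; apply: bb'.
rewrite -rep_ex; split=> [[[w b] mE]|[w [b mE]]].
  by exists w, (fun i => b i : nat).
have lt_b i : (b i < (mdeg m).+1)%N by rewrite ltnS mE leq_mdeg_lincomb.
exists (w, [ffun i => Ordinal (lt_b i)]); rewrite {1}mE; congr (_ + _)%MM.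
by apply: eq_bigr => i _; rewrite ffunE.
Qed.

End GeometricSeries.

Section ConsMultidegrees.
Variable n : nat.
Implicit Type m : 'X_{1..n.+1}.

Definition ord_cons (T : Type) (x : T) (f : 'I_n -> T) (i : 'I_n.+1) : T :=
  oapp f x (unlift ord0 i).

Definition ord_tail (T : Type) (f : 'I_n.+1 -> T) (j : 'I_n) : T :=
  f (lift ord0 j).

Lemma ord_cons0 T (x : T) f : ord_cons x f ord0 = x.
Proof. by rewrite /ord_cons unlift_none. Qed.

Lemma ord_consS T (x : T) f j : ord_cons x f (lift ord0 j) = f j.
Proof. by rewrite /ord_cons liftK. Qed.

Definition mnm_cons k b : 'X_{1..n.+1} := [multinom ord_cons k b i | i < n.+1].

Lemma mnm_consP m k b : m = mnm_cons k b <-> m ord0 = k /\ ord_tail m =1 b.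
Proof.
split=> [->|[m0 m_tail]].
  by rewrite mnmE ord_cons0; split=> // j; rewrite /ord_tail mnmE ord_consS.
apply/mnmP => i; rewrite mnmE.
by have [j ->|->] := unliftP ord0 i; rewrite ?ord_cons0 ?ord_consS // -m_tail.
Qed.

Local Open Scope ring_scope.
Variable R : comNzRingType.

Lemma mps_mon_cons k b :
  mps_mon R (mnm_cons k b) =
  (\prod_(j < n) mpsX R (lift ord0 j) ^+ b j) * mpsX R ord0 ^+ k.
Proof.
rewrite mps_mon_prodX big_ord_recl mulrC mnmE ord_cons0; congr (_ * _).
by apply: eq_bigr => j _; rewrite mnmE ord_consS.
Qed.

Lemma mpscoef_prod_qint N k m :
  mpscoef ((\prod_(j < n) qint N (mpsX R (lift ord0 j))) * mpsX R ord0 ^+ k) m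
  = ((m ord0 == k) && [forall j, ord_tail m j < N]%N)%:R.
Proof.
have -> : (\prod_(j < n) qint N (mpsX R (lift ord0 j))) * mpsX R ord0 ^+ k =
    \sum_(b : {ffun 'I_n -> 'I_N}) mps_mon R (mnm_cons k (fun j => b j)).
  rewrite /qint bigA_distr_bigA mulr_suml.
  by apply: eq_bigr => b _; rewrite mps_mon_cons.
apply: mpscoef_sum_mon_unique => [b b' /mnm_consP[_ mb] /mnm_consP[_ mb']|].
  by apply/ffunP => j; apply: val_inj; rewrite /= -mb mb'.
split=> [[b /mnm_consP[-> mb]]|/andP[/eqP m0 /forallP lt_mN]].
  by rewrite eqxx; apply/forallP => j; rewrite mb.
exists [ffun j => Ordinal (lt_mN j)].
by apply/mnm_consP; split=> // j; rewrite ffunE.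
Qed.

End ConsMultidegrees.

(** * Functions sorted by a permutation *)

Section OrdinalSequences.
Variable n : nat.

Definition ord_ext (T : Type) (x0 : T) (f : 'I_n -> T) (j : nat) : T :=
  oapp f x0 (insub j).

Lemma ord_extE T (x0 : T) f (i : 'I_n) : ord_ext x0 f i = f i.
Proof. by rewrite /ord_ext valK. Qed.

Lemma ord_ext_out T (x0 : T) f j : n <= j -> ord_ext x0 f j = x0.
Proof. by move=> le_nj; rewrite /ord_ext insubN // -leqNgt. Qed.

Lemma ord_down_ind (P : nat -> Prop) :
    (forall j, n <= j -> P j) -> (forall j : 'I_n, P j.+1 -> P j) ->
  forall j, P j.
Proof.
move=> Pout PS j; have [d] := ubnP (n - j); elim: d j => // d IHd j lt_d.
have [/Pout//|lt_jn] := leqP n j.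
by apply: (PS (Ordinal lt_jn)); apply: IHd => /=; lia.
Qed.

Lemma sum_ord_tailS (V : nmodType) (d : 'I_n -> V) (i : 'I_n) :
  (\sum_(j < n | (i <= j)%N) d j = \sum_(j < n | (i < j)%N) d j + d i)%R.
Proof.
rewrite (bigD1 i) //= addrC; congr (_ + _)%R; apply: eq_bigl => j.
by rewrite ltn_neqAle eq_sym andbC.
Qed.

Lemma ord_ext_gap_sum (V : nmodType) (f d : 'I_n -> V) :
    (forall j : 'I_n, ord_ext 0%R f j = (ord_ext 0 f j.+1 + d j)%R) ->
  forall i : nat, (ord_ext 0 f i = \sum_(j < n | (i <= j)%N) d j)%R.
Proof.
move=> f_gap; apply: ord_down_ind => [i le_ni | i IHi].
  rewrite ord_ext_out // big_pred0 // => j.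
  by rewrite leqNgt (leq_trans (ltn_ord j) le_ni).
by rewrite f_gap IHi -sum_ord_tailS.
Qed.

Lemma ord_ext_gapP (V : nmodType) (f d : 'I_n -> V) :
  (forall j : 'I_n, ord_ext 0%R f j = (ord_ext 0 f j.+1 + d j)%R) <->
  (forall i : 'I_n, (f i = \sum_(j < n | (i <= j)%N) d j)%R).
Proof.
split=> [f_gap i | f_sum i]; first by rewrite -(ord_ext_gap_sum f_gap) ord_extE.
rewrite ord_extE f_sum sum_ord_tailS; congr (_ + _)%R.
have [le_ni|lt_in] := leqP n i.+1; last first.
  by rewrite (ord_extE _ _ (Ordinal lt_in)) f_sum.
rewrite ord_ext_out // big_pred0 // => j.
by rewrite ltnNge -ltnS (leq_trans (ltn_ord j) le_ni).
Qed.

Lemma sorted_codomP (T : Type) (e : rel T) (f : 'I_n -> T) :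
  reflect (forall j j' : 'I_n, j' = j.+1 :> nat -> e (f j) (f j'))
          (sorted e (codom f)).
Proof.
rewrite codomE sorted_map; case: n f => [|m] f.
  by rewrite (size0nil (size_enum_ord 0)); constructor=> [[]].
apply: (iffP (sortedP ord0)) => [f_sorted j j' jj' | f_sorted i].
  by have := f_sorted j; rewrite size_enum_ord -jj' !nth_ord_enum; apply.
rewrite size_enum_ord => lt_im.
by apply: f_sorted; rewrite !nth_enum_ord // ltnW.
Qed.

Lemma codom_perm_inj (p q : 'S_n) : codom p = codom q -> p = q.
Proof.
rewrite !codomE => pq; apply/permP=> i.
by move/eq_in_map: pq; apply; rewrite mem_enum.
Qed.

Section SortingPermutation.
Variable e : rel 'I_n.

Lemma sorting_perm_exists : total e -> exists p : 'S_n, sorted e (codom p).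
Proof.
move=> e_total.
have /tuple_permP[p pE] : perm_eq (sort e (enum 'I_n)) (ord_tuple n).
  by rewrite perm_sort val_ord_tuple.
exists p; rewrite (_ : codom p = sort e (enum 'I_n)) ?sort_sorted //.
by rewrite pE codomE /=; apply: eq_map => i; rewrite tnth_ord_tuple.
Qed.

Lemma sorting_perm_unique (p q : 'S_n) : transitive e -> antisymmetric e ->
  sorted e (codom p) -> sorted e (codom q) -> p = q.
Proof.
move=> e_trans e_anti p_sorted q_sorted; apply: codom_perm_inj.
apply: sorted_eq p_sorted q_sorted _ => //; apply: uniq_perm => [||i].
- exact/injectiveP/perm_inj.
- exact/injectiveP/perm_inj.
- by rewrite -(permKV p i) codom_f permKV -(permKV q i) codom_f.
Qed.

End SortingPermutation.

Lemma DesP (p : 'S_n) (j j' : 'I_n) :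
  j' = j.+1 :> nat -> (j \in Des p) = (p j' < p j).
Proof.
move=> jj'; rewrite inE; apply/existsP/idP => [[i /andP[/eqP iE]]|lt].
  by rewrite (_ : i = j') //; apply: val_inj; rewrite /= iE.
by exists j'; rewrite jj' eqxx.
Qed.

Lemma Des_last (p : 'S_n) (j : 'I_n) : n <= j.+1 -> (j \in Des p) = false.
Proof.
move=> le_nj; rewrite inE; apply/existsP=> -[i /andP[/eqP iE _]].
by have := ltn_ord i; rewrite iE ltnNge le_nj.
Qed.

End OrdinalSequences.

Section CompatiblePermutations.
Variables (n : nat) (v : 'I_n -> nat).
Implicit Type p : 'S_n.

Definition at_pos p : nat -> nat := ord_ext 0 (v \o p).

Lemma at_pos_ord p (i : 'I_n) : at_pos p i = v (p i).
Proof. exact: ord_extE. Qed.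

Lemma at_pos_out p j : n <= j -> at_pos p j = 0.
Proof. exact: ord_ext_out. Qed.

Definition compatible p : Prop :=
  forall j : 'I_n, at_pos p j.+1 + (j \in Des p) <= at_pos p j.

Definition fall p (j : nat) : nat := at_pos p j - at_pos p j.+1.

Lemma compatible_leqS p j : compatible p -> at_pos p j.+1 <= at_pos p j.
Proof.
move=> p_comp; have [le_nj|lt_jn] := leqP n j.
  by rewrite at_pos_out // leqW.
exact: leq_trans (leq_addr _ _) (p_comp (Ordinal lt_jn)).
Qed.

Lemma compatible_leq_head p j : compatible p -> at_pos p j <= at_pos p 0.
Proof.
move=> p_comp; elim: j => // j; exact: leq_trans (compatible_leqS j p_comp).
Qed.

Definition precedes : rel 'I_n :=
  fun x y => (v y < v x) || (v x == v y) && (x <= y).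

Lemma precedes_trans : transitive precedes.
Proof. by move=> y x z; rewrite /precedes; lia. Qed.

Lemma precedes_anti : antisymmetric precedes.
Proof. by move=> x y; rewrite /precedes => xy; apply: val_inj => /=; lia. Qed.

Lemma precedes_total : total precedes.
Proof. by move=> x y; rewrite /precedes; lia. Qed.

Lemma compatible_sortedP p :
  compatible p <-> sorted precedes (codom p).
Proof.
have stepE (j j' : 'I_n) : j' = j.+1 :> nat ->
    (at_pos p j.+1 + (j \in Des p) <= at_pos p j) = precedes (p j) (p j').
  move=> jj'; rewrite -jj' !at_pos_ord (DesP p jj') /precedes.
  by have [] := leqP (p j) (p j'); lia.
split=> [p_comp | /sorted_codomP p_sorted j].
  by apply/sorted_codomP => j j' jj'; rewrite -stepE.
have [le_nj|lt_jn] := leqP n j.+1; first by rewrite Des_last // at_pos_out.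
by rewrite (stepE j (Ordinal lt_jn)) ?p_sorted.
Qed.

Lemma compatible_exists : exists p, compatible p.
Proof.
have [p p_sorted] := sorting_perm_exists precedes_total.
by exists p; apply/compatible_sortedP.
Qed.

Lemma compatible_unique p q : compatible p -> compatible q -> p = q.
Proof.
move=> /compatible_sortedP p_sorted /compatible_sortedP q_sorted.
exact: sorting_perm_unique precedes_trans precedes_anti p_sorted q_sorted.
Qed.

Lemma compatible_leq_max p k : compatible p ->
  (at_pos p 0 <= k) = [forall x, v x <= k].
Proof.
move=> p_comp; apply/idP/forallP => [le_k x|le_k].
  have -> : v x = at_pos p (p^-1%g x) by rewrite at_pos_ord permKV.
  exact: leq_trans (compatible_leq_head _ p_comp) le_k.
have [le_n0|lt_0n] := leqP n 0; first by rewrite at_pos_out.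
by rewrite (at_pos_ord p (Ordinal lt_0n)).
Qed.

End CompatiblePermutations.

(** * Colored permutations *)

Lemma ceil_div_ge0 (a r : nat) : (0 <= Num.ceil (a%:Q / r%:Q))%R.
Proof. by rewrite ceil_ge0 (lt_le_trans (ltrN10 _)) // divr_ge0 // ler0n. Qed.

Lemma leq_ceil_div r a k : 0 < r -> (ceil_div a r <= k) = (a <= r * k).
Proof.
move=> r_gt0; rewrite -lez_nat gez0_abs ?ceil_div_ge0 //.
by rewrite ceil_le_int ler_pdivrMr ?ltr0n // -natrM ler_nat mulnC.
Qed.

Lemma ceil_divDMl r a t : 0 < r -> ceil_div (a + r * t) r = ceil_div a r + t.
Proof.
move=> r_gt0; rewrite /ceil_div.
have -> : ((a + r * t)%N%:Q / r%:Q = a%:Q / r%:Q + t%:~R)%R.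
  rewrite PoszD PoszM !rmorphD rmorphM mulrDl [(r%:~R * _)%R]mulrC mulfK //.
  by rewrite pnatr_eq0 -lt0n.
rewrite ceilDrz ?intr_int // intrKceil; apply/eqP.
by rewrite -eqz_nat PoszD !gez0_abs ?addr_ge0 ?ceil_div_ge0.
Qed.

Section Colors.
Variables (r n : nat) (c : {ffun 'I_n -> 'I_r}).

Lemma color_ord (i : 'I_n) : color c i = c i.
Proof. exact: (ord_extE 0 (fun i => c i : nat)). Qed.

Lemma color_out j : n <= j -> color c j = 0.
Proof. exact: (ord_ext_out 0 (fun i => c i : nat)). Qed.

Hypothesis r_gt0 : 0 < r.

Lemma color_lt j : color c j < r.
Proof. by rewrite /color; case: insub => //= i. Qed.

Lemma color_change_lt j : color_change c j < r.
Proof. by rewrite /color_change; lia. Qed.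

Lemma color_change_modn (j : 'I_n) :
  color c j.+1 + color_change c j = color c j %[mod r].
Proof.
apply/eqP; rewrite -eqz_nat -!modz_nat PoszD gez0_abs.
  by rewrite modzDmr addrC subrK.
by rewrite modz_ge0 // -lt0n.
Qed.

End Colors.

Section Encoding.
Variables r n : nat.
Hypothesis r_gt0 : 0 < r.
Implicit Types (w : wreath r n) (v b : 'I_n -> nat).

Definition flat_des w (j : 'I_n) : bool :=
  (j \in Des w.1) && (color_change w.2 j == 0).

(* The difference of the exponents of z_(pi(j)) and z_(pi(j+1)) in the term   *)
(* of index b of the expansion of the summand of w.                           *)
Definition gap w b (j : 'I_n) : nat :=
  color_change w.2 j + r * (flat_des w j + b j).

Lemma sum_gap w b :
  \sum_(j < n) gap w b j =
  total_change w.2 + r * (\sum_(j < n) flat_des w j + \sum_(j < n) b j).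
Proof. by rewrite /gap big_split /= -big_distrr big_split. Qed.

Definition encodes w b v : Prop :=
  forall j : 'I_n, at_pos v w.1 j = at_pos v w.1 j.+1 + gap w b j.

Lemma encodes_tail_sumP w b v :
  encodes w b v <->
  forall i : 'I_n, v (w.1 i) = \sum_(j < n | i <= j) gap w b j.
Proof. exact: (@ord_ext_gapP n nat). Qed.

Lemma encodes_sum_gap w b v :
  encodes w b v -> at_pos v w.1 0 = \sum_(j < n) gap w b j.
Proof.
move=> w_enc; rewrite [LHS](@ord_ext_gap_sum n nat _ _ w_enc).
exact: eq_bigl.
Qed.

Definition residue_colored w v : Prop :=
  forall j : nat, color w.2 j = at_pos v w.1 j %% r.

Lemma residue_colored_unique v p (c c' : {ffun 'I_n -> 'I_r}) :
  residue_colored (p, c) v -> residue_colored (p, c') v -> c = c'.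
Proof.
move=> c_res c'_res; apply/ffunP => i; apply: val_inj.
by rewrite /= -!color_ord c_res c'_res.
Qed.

Lemma residue_colored_exists v p : exists c, residue_colored (p, c) v.
Proof.
exists [ffun i => Ordinal (ltn_pmod (v (p i)) r_gt0)] => j.
rewrite /= /color /at_pos /ord_ext.
by case: insub => [i|] /=; rewrite ?ffunE ?mod0n.
Qed.

Lemma color_change_residue w v j :
    compatible v w.1 -> residue_colored w v ->
  color_change w.2 j = fall v w.1 j %% r.
Proof.
move=> w_comp w_res; rewrite -[LHS](modn_small (color_change_lt _ r_gt0 _)).
apply/eqP; rewrite -(eqn_modDl (at_pos v w.1 j.+1)) subnKC ?compatible_leqS //.
by rewrite -modnDml -w_res color_change_modn // w_res modn_mod.
Qed.

Lemma flat_des_leq w v j : compatible v w.1 -> residue_colored w v ->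
  flat_des w j <= fall v w.1 j %/ r.
Proof.
move=> w_comp w_res; case j_flat: (flat_des w j) => //.
case/andP: j_flat => j_des; rewrite (color_change_residue j w_comp w_res).
move=> dvd_r; rewrite divn_gt0 // dvdn_leq // subn_gt0.
by have := w_comp j; rewrite j_des addn1.
Qed.

Lemma encodes_compatible w b v : encodes w b v -> compatible v w.1.
Proof.
move=> w_enc j; rewrite w_enc leq_add2l /gap /flat_des.
by case: (j \in Des _) => //; case: eqVneq => [->|] /=; rewrite ?muln_gt0; lia.
Qed.

Lemma encodes_residue_colored w b v : encodes w b v -> residue_colored w v.
Proof.
move=> w_enc; apply: (@ord_down_ind n) => [j le_nj|j IHj].
  by rewrite color_out // at_pos_out // mod0n.
rewrite -(modn_small (color_lt _ r_gt0 j)) -color_change_modn // IHj modnDml.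
by rewrite w_enc /gap addnA -[RHS]modnDmr modnMr addn0.
Qed.

Lemma encodesP w b v :
  encodes w b v <->
  [/\ compatible v w.1, residue_colored w v &
      forall j, flat_des w j + b j = fall v w.1 j %/ r].
Proof.
split=> [w_enc | [w_comp w_res b_quo] j].
  split=> [||j].
  - exact: encodes_compatible w_enc.
  - exact: encodes_residue_colored w_enc.
  - rewrite /fall w_enc addKn divnDr ?dvdn_mulr // mulKn //.
    by rewrite divn_small ?color_change_lt.
rewrite /gap b_quo (color_change_residue j w_comp w_res).
rewrite addnC [r * _]mulnC [_ %% r + _]addnC -divn_eq.
by rewrite subnK ?compatible_leqS.
Qed.

Lemma encodes_unique v w w' b b' :
  encodes w b v -> encodes w' b' v -> w = w' /\ b =1 b'.
Proof.
case: w w' => [p c] [p' c'] /encodesP/= [p_comp c_res b_quo].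
move=> /encodesP/= [p'_comp c'_res b'_quo].
have pp' := compatible_unique p_comp p'_comp.
rewrite -{p' p'_comp}pp' in c'_res b'_quo *.
have cc' := residue_colored_unique c_res c'_res.
rewrite -{c' c'_res}cc' in b'_quo *.
by split=> // j; apply: (@addnI (flat_des (p, c) j)); rewrite b_quo b'_quo.
Qed.

Lemma encodes_exists v : exists w b, encodes w b v.
Proof.
have [p p_comp] := compatible_exists v.
have [c c_res] := residue_colored_exists v p.
exists (p, c), (fun j : 'I_n => fall v p j %/ r - flat_des (p, c) j).
by apply/encodesP; split=> // j; rewrite subnKC //; apply: flat_des_leq.
Qed.

End Encoding.

Section WreathTerms.
Variables r n : nat.
Implicit Types (w : wreath r n) (p : 'S_n) (b : 'I_n.+1 -> nat).
Implicit Types (m : 'X_{1..n.+1}).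

Definition prefix_mnm p (j e : nat) : 'X_{1..n.+1} :=
  (\sum_(i < n | (i < j)%N) U_(lift ord0 (p i)) *+ e)%MM.

Definition step_mnm p (j : nat) : 'X_{1..n.+1} :=
  (U_(ord0) + prefix_mnm p j r)%MM.

Definition num_mnm w : 'X_{1..n.+1} :=
  (U_(ord0) *+ ceil_div (total_change w.2) r
   + \sum_(j < n) prefix_mnm w.1 j.+1 (color_change w.2 j)
   + \sum_(j < n | flat_des w j) step_mnm w.1 j.+1)%MM.

Definition term_mnm w b : 'X_{1..n.+1} :=
  (num_mnm w + \sum_(j < n.+1) step_mnm w.1 j *+ b j)%MM.

Section Series.
Local Open Scope ring_scope.

Lemma zprefixE p j e : zprefix p j e = mps_mon int (prefix_mnm p j e).
Proof. by rewrite mps_mon_sum; apply: eq_bigr => i _; rewrite mps_monMn. Qed.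

Lemma z0_zprefixE p j : z0 n * zprefix p j r = mps_mon int (step_mnm p j).
Proof. by rewrite zprefixE mps_monD. Qed.

Lemma wreath_numE w : wreath_num w = mps_mon int (num_mnm w).
Proof.
rewrite !mps_monD mps_monMn !mps_mon_sum; congr (_ * _ * _).
  by apply: eq_bigr => j _; rewrite zprefixE.
by apply: eq_bigr => j _; rewrite z0_zprefixE.
Qed.

Lemma wreath_denE w :
  wreath_den w = \prod_(j < n.+1) (1 - mps_mon int (step_mnm w.1 j)).
Proof. by apply: eq_bigr => j _; rewrite z0_zprefixE. Qed.

End Series.

Lemma prefix_mnm_ord0 p j e : prefix_mnm p j e ord0 = 0.
Proof. by rewrite mnm_sumE big1 // => i _; rewrite mulmnE mnm1E. Qed.

Lemma prefix_mnm_tail p j e (i : 'I_n) :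
  ord_tail (prefix_mnm p j e) (p i) = (i < j) * e.
Proof.
rewrite /ord_tail mnm_sumE big_mkcond (bigD1 i) //= big1 => [|i' neq_i].
  by rewrite mulmnE mnm1E eqxx addn0; case: ifP; rewrite ?mul1n ?mul0n.
rewrite mulmnE mnm1E (inj_eq lift_inj) (inj_eq perm_inj) (negPf neq_i).
by case: ifP.
Qed.

Lemma step_mnm_ord0 p j : step_mnm p j ord0 = 1.
Proof. by rewrite mnmDE prefix_mnm_ord0 mnm1E eqxx. Qed.

Lemma step_mnm_tail p j (i : 'I_n) :
  ord_tail (step_mnm p j) (p i) = (i < j) * r.
Proof. by rewrite /ord_tail mnmDE mnm1E; apply: prefix_mnm_tail. Qed.

Lemma step_mnm_neq0 p j : step_mnm p j != 0%MM.
Proof. by apply/eqP => /mnmP/(_ ord0); rewrite step_mnm_ord0 mnm0E. Qed.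

Lemma term_mnm_tail w b (i : 'I_n) :
  ord_tail (term_mnm w b) (w.1 i) =
  \sum_(j < n | i <= j) gap w (ord_tail b) j.
Proof.
have tailE m j : m (lift ord0 j) = ord_tail m j by [].
rewrite /ord_tail !mnmDE !mnm_sumE mulmnE mnm1E mul0n add0n.
rewrite big_ord_recl mulmnE tailE step_mnm_tail ltn0 !mul0n add0n.
rewrite (big_mkcond (flat_des w)) -!big_split [RHS]big_mkcond.
apply: eq_bigr => j _ /=.
rewrite mulmnE !tailE prefix_mnm_tail !step_mnm_tail ltnS /gap.
by case: leqP => _; case: (flat_des w j) => /=; lia.
Qed.

Hypothesis r_gt0 : 0 < r.

Lemma term_mnm_ord0 w b :
  term_mnm w b ord0 =
  b ord0 + ceil_div (\sum_(j < n) gap w (ord_tail b) j) r.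
Proof.
rewrite sum_gap ceil_divDMl // !mnmDE !mnm_sumE mulmnE mnm1E eqxx mul1n.
rewrite big1 ?addn0 => [|j _]; last exact: prefix_mnm_ord0.
rewrite big_mkcond big_ord_recl mulmnE step_mnm_ord0 mul1n addnCA.
congr (_ + _); rewrite -addnA; congr (_ + (_ + _)); apply: eq_bigr => j _.
  by case: (flat_des w j); rewrite ?step_mnm_ord0.
by rewrite mulmnE step_mnm_ord0 mul1n.
Qed.

Lemma term_mnmP m w b :
  m = term_mnm w b <->
  encodes w (ord_tail b) (ord_tail m) /\
  m ord0 = b ord0 + ceil_div (at_pos (ord_tail m) w.1 0) r.
Proof.
have term_enc : encodes w (ord_tail b) (ord_tail (term_mnm w b)).
  by apply/encodes_tail_sumP => i; rewrite term_mnm_tail.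
split=> [->|[w_enc m0]].
  by rewrite term_mnm_ord0 (encodes_sum_gap term_enc).
apply/mnmP => i; have [x ->|->] := unliftP ord0 i.
  have /encodes_tail_sumP/(_ (w.1^-1%g x)) := w_enc.
  by rewrite -term_mnm_tail permKV.
by rewrite m0 term_mnm_ord0 (encodes_sum_gap w_enc).
Qed.

Lemma term_mnm_unique m w w' b b' :
  m = term_mnm w b -> m = term_mnm w' b' -> w = w' /\ b =1 b'.
Proof.
move=> /term_mnmP[w_enc m0] /term_mnmP[w'_enc m0'].
have [ww' bb'] := encodes_unique r_gt0 w_enc w'_enc; rewrite -{}ww' in m0' *.
split=> // i; have [j ->|->] := unliftP ord0 i; first exact: bb'.
by apply: (@addIn (ceil_div (at_pos (ord_tail m) w.1 0) r)); rewrite -m0 -m0'.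
Qed.

Lemma term_mnm_existsP m :
  (exists w b, m = term_mnm w b) <->
  [forall x, ord_tail m x <= r * m ord0].
Proof.
split=> [[w [b /term_mnmP[/(encodes_compatible r_gt0) w_comp ->]]]|m_cone].
  by rewrite -(compatible_leq_max _ w_comp) -leq_ceil_div // leq_addl.
have [w [b w_enc]] := encodes_exists r_gt0 (ord_tail m).
pose top := ceil_div (at_pos (ord_tail m) w.1 0) r.
have le_top : top <= m ord0.
  have w_comp := encodes_compatible r_gt0 w_enc.
  by rewrite /top leq_ceil_div // compatible_leq_max.
exists w, (ord_cons (m ord0 - top) b); apply/term_mnmP; split=> [j|].
  by rewrite w_enc /gap /ord_tail ord_consS.
by rewrite ord_cons0 subnK.
Qed.

End WreathTerms.

Local Open Scope ring_scope.

Theorem theorem5p23 (r n : nat) (r_gt0 : (0 < r)%N) (n_gt0 : (0 < n)%N) :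
  is_mpsum
    (fun k : nat => (\prod_(j < n) qint (r * k + 1)%N (zv j)) * z0 n ^+ k)
    (\sum_(w : wreath r n) wreath_num w / wreath_den w).
Proof.
apply: (is_mpsum_graded (grade := fun m => m ord0)) => [k m neq_k|m].
  by rewrite mpscoef_prod_qint eq_sym (negPf neq_k).
rewrite mpscoef_prod_qint eqxx addn1.
under eq_bigr => w _ do rewrite wreath_numE wreath_denE.
apply: mpscoef_sum_mon_div_prod_unique => [w j|w w' b b'|].
- exact: step_mnm_neq0.
- exact: term_mnm_unique.
- exact: term_mnm_existsP.
Qed.
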